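(* Let $X$ be a uniformly convex and uniformly smooth Banach space and let $A:X\to 2^X$ be an m-accretive operator such that there exists a weak modulus for the convergence condition $\Omega:\mathbb{N}\times\mathbb{N}^{\mathbb{N}}\to\mathbb{N}^{\mathbb{N}}$ for $A$. Let $\mathcal{S}=\{S(t)\mid t\geq 0\}$ be the semigroup generated by $A$ via the exponential formula. Let $A^{-1}0\neq\emptyset$ with $p\in A^{-1}0$ and assume that $P$, the nearest point projection onto $A^{-1}0$, is uniformly continuous on bounded subsets of $X$ with a modulus $\omega:\mathbb{N}^2\to\mathbb{N}$, i.e. $$\forall r,k\in\mathbb{N}\ \forall x,y\in \overline{B}_r(p) \left( \|x-y\|\leq \frac{1}{\omega(r,k)+1} \to \|Px-Py\|\leq \frac{1}{k+1} \right),$$ and (without loss of generality) that $\omega(r,k)\geq k$ for all $r,k\in\mathbb{N}$. Let $u$ be an almost-orbit of $\mathcal{S}$ with a rate of convergence $\Phi:\mathbb{N}\to\mathbb{N}$ on the almost-orbit condition, i.e. $$\forall k\in\mathbb{N}\ \forall s\geq \Phi(k)\left( \sup_{t\geq 0}\|u(s+t)-S(t)u(s)\|\leq\frac{1}{k+1}\right).$$ Let $B\in\mathbb{N}\setminus\{0\}$ be such that $\|u(t)-p\|\leq B$ for all $t\geq 0$ and, for each $s\geq 0$, let $f_s:\mathbb{N}\to\mathbb{N}$ be nondecreasing and such that $$\forall n\in\mathbb{N}\ \exists x_{s,n},y_{s,n}\in X\left(y_{s,n}\in Ax_{s,n}\land \|x_{s,n}\|,\|y_{s,n}\|\leq f_s(n)\land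 \|x_{s,n}-u(s)\|\leq\frac{1}{n+1}\right).$$ Then we have $$\forall k\in\mathbb{N}\ \forall t,t'\geq \max\{\Phi(8k+7),s^*+\Omega_{s^*}(24k+23)\}\left(\|u(t)-u(t')\|\leq\frac{1}{k+1}\right),$$ where $s^*=\Phi(\omega(B,24k+23))$ and where $\Omega_s(k)$ for $s\geq 0$ is defined by $$\Omega_s(k):=\chi(\Omega(K_{s,k},\mathrm{id})(3k+2)),\qquad \chi(k):=\left\lceil\frac{1}{2}(B+1)^2+1\right\rceil(k+1),$$ for any $K_{s,k}\in\mathbb{N}$ with $K_{s,k}\geq\max\{f_s(\omega(B+1, 3k+2)), B+1+\|p\|\}$.
   Context: $\mathbb{N}=\{0,1,2,\dots\}$ and $\mathrm{id}:\mathbb{N}\to\mathbb{N}$ is the identity; $t,t',s$ range over reals. $\overline{B}_r(p)$ is the closed ball of radius $r$ around $p$. $X$ is a real Banach space. Since $X$ is uniformly smooth, its normalized duality map $J(x)=\{f\in X^*\mid f(x)=\|x\|^2,\ \|f\|=\|x\|\}$ is single-valued; it is identified with a map $J:X\to X^*$ and $\langle y,J(x)\rangle$ denotes $J(x)(y)$. A set-valued operator $A:X\to 2^X$ is identified with its graph $\{(x,y)\mid y\in Ax\}$; $\mathrm{dom}A=\{x\mid Ax\neq\emptyset\}$ and $A^{-1}0=\{x\mid 0\in Ax\}$. $A$ is accretive if $\langle y_1-y_2,J(x_1-x_2)\rangle\geq 0$ for all $(x_1,y_1),(x_2,y_2)\in A$, and m-accretive if in addition $\mathrm{ran}(\mathrm{Id}+\gamma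 A)=X$ for all $\gamma>0$. If $A$ is m-accretive with $A^{-1}0\neq\emptyset$, then $A^{-1}0$ is closed and convex and $P$ denotes the (single-valued) nearest point projection of $X$ onto $A^{-1}0$. The semigroup generated by $A$ via the exponential formula is given by $S(t)x=\lim_{n\to\infty}(\mathrm{Id}+\frac{t}{n}A)^{-n}x$ for $x\in\overline{\mathrm{dom}A}$, $t\geq 0$ (the limit exists by the Crandall–Liggett theorem, and the $S(t)$ form a semigroup of nonexpansive maps on $\overline{\mathrm{dom}A}$, continuous in $t$). An almost-orbit of $\mathcal{S}$ is a continuous function $u:[0,\infty)\to\overline{\mathrm{dom}A}$ such that $\lim_{s\to\infty}\sup\{\|u(t+s)-S(t)u(s)\|\mid t\geq 0\}=0$. For a sequence $(a_n)$ of non-negative reals, $\varphi:\mathbb{N}\to\mathbb{N}$ is a rate of convergence (towards zero) if $\forall k\,\forall n\geq\varphi(k)\,(a_n\leq\frac{1}{k+1})$, and a rate of approximate zeros if $\forall k\,\exists n\leq\varphi(k)\,(a_n\leq\frac1{k+1})$. A weak modulus for the convergence condition for $A$ is a functional $\Omega:\mathbb{N}\times\mathbb{N}^{\mathbb{N}}\to\mathbb{N}^{\mathbb{N}}$ such that for any sequences $(x_n),(y_n)\subseteq X$, any $K\in\mathbb{N}$ and any $\varphi:\mathbb{N}\to\mathbb{N}$: if $y_n\in Ax_n$ and $\|x_n\|,\|y_n\|\leq K$ for all $n$, and $\varphi$ is a rate of convergence for $|\langle y_n,J(x_n-Px_n)\rangle|$, then $\Omega(K,\varphi)$ is a rate of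 approximate zeros for $\|x_n-Px_n\|$. *)

(* Defs.v *)
From HB Require Import structures.
From mathcomp Require Import all_boot all_order all_algebra.
From mathcomp Require Import all_classical all_reals all_analysis.
Set Implicit Arguments.
Unset Strict Implicit.
Unset Printing Implicit Defensive.
Import Order.TTheory GRing.Theory Num.Theory.
Import numFieldNormedType.Exports.
Local Open Scope classical_set_scope.
Local Open Scope ring_scope.

Definition uniformly_convex (R : realType) (X : normedModType R) : Prop :=
  forall e : R, 0 < e -> exists2 d : R, 0 < d &
    forall x y : X, `|x| <= 1 -> `|y| <= 1 -> e <= `|x - y| ->
      `|2^-1 *: (x + y)| <= 1 - d.

(* The epsilon-delta form of  rho(tau) / tau --> 0,  where rho is the modulus of
   smoothness rho(tau) = sup {(|x + y| + |x - y|) / 2 - 1 : |x| = 1, |y| = tau}. *)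
Definition uniformly_smooth (R : realType) (X : normedModType R) : Prop :=
  forall e : R, 0 < e -> exists2 d : R, 0 < d &
    forall x y : X, `|x| = 1 -> `|y| <= d ->
      `|x + y| + `|x - y| <= 2 + e * `|y|.

Section operators.
Variables (R : realType) (X : completeNormedModType R).

Definition dual_norm (f : X -> R) : R := sup [set `|f x| | x in [set x | `|x| <= 1]].

Definition duality_set (x : X) : set (X -> R) :=
  [set f | [/\ linear (f : X -> R^o), continuous f,
               f x = `|x| ^+ 2 & dual_norm f = `|x|]].

(* In a uniformly smooth space duality_set x is a singleton and J x is its
   element; pairing is <y, J x>. *)
Definition J (x : X) : X -> R := xget (fun=> 0) (duality_set x).

Definition pairing (y x : X) : R := J x y.

(* A set-valued operator is a map A : X -> set X, with A x y meaning y \in A x. *)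
Definition dom (A : X -> set X) : set X := [set x | A x !=set0].

Definition zeros (A : X -> set X) : set X := [set x | A x 0].

Definition accretive (A : X -> set X) : Prop :=
  forall x1 y1 x2 y2, A x1 y1 -> A x2 y2 -> 0 <= pairing (y1 - y2) (x1 - x2).

Definition range_Id_plus (A : X -> set X) (g : R) : set X :=
  [set z | exists x y, A x y /\ z = x + g *: y].

Definition m_accretive (A : X -> set X) : Prop :=
  accretive A /\ forall g : R, 0 < g -> range_Id_plus A g = setT.

Definition nearest_points (C : set X) (x : X) : set X :=
  [set q | C q /\ forall z, C z -> `|x - q| <= `|x - z|].

(* The nearest point projection onto C; the default x is only used when
   nearest_points C x is empty. *)
Definition nearest_proj (C : set X) (x : X) : X := xget x (nearest_points C x).

(* (Id + g A)^-1. For g > 0 and A m-accretive, the set below is a singleton.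
   The default z makes this the identity for g = 0, also outside dom A, so that
   semigroup A 0 x = x on the whole closure of dom A. *)
Definition resolvent (A : X -> set X) (g : R) (z : X) : X :=
  xget z [set x | exists2 y, A x y & z = x + g *: y].

Definition semigroup (A : X -> set X) (t : R) (x : X) : X :=
  lim (iter n (resolvent A (t / n%:R)) x @[n --> \oo]).

(* The supremum is taken in \bar R, since sup in R is 0 on unbounded sets. *)
Definition orbit_gap (A : X -> set X) (u : R -> X) (s : R) : \bar R :=
  ereal_sup [set (`|u (s + t) - semigroup A t (u s)|)%:E | t in [set t : R | 0 <= t]].

Definition almost_orbit (A : X -> set X) (u : R -> X) : Prop :=
  [/\ {within [set t : R | 0 <= t], continuous u},
      forall t : R, 0 <= t -> closure (dom A) (u t) &
      orbit_gap A u s @[s --> +oo] --> 0%E].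

Definition rate_of_convergence (phi : nat -> nat) (a : nat -> R) : Prop :=
  forall k n, (phi k <= n)%N -> a n <= k.+1%:R^-1.

Definition rate_of_approximate_zeros (phi : nat -> nat) (a : nat -> R) : Prop :=
  forall k, exists2 n, (n <= phi k)%N & a n <= k.+1%:R^-1.

Definition weak_modulus_convergence_condition (A : X -> set X)
    (Omega : nat -> (nat -> nat) -> nat -> nat) : Prop :=
  forall (x y : nat -> X) (K : nat) (phi : nat -> nat),
    (forall n, [/\ A (x n) (y n), `|x n| <= K%:R & `|y n| <= K%:R]) ->
    rate_of_convergence phi
      (fun n => `|pairing (y n) (x n - nearest_proj (zeros A) (x n))|) ->
    rate_of_approximate_zeros (Omega K phi)
      (fun n => `|x n - nearest_proj (zeros A) (x n)|).

(* The balls are written with the norm because closed_ball p 0 is empty in the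
   library. *)
Definition uniform_continuity_modulus (P : X -> X) (p : X)
    (omega : nat -> nat -> nat) : Prop :=
  forall (r k : nat) (x y : X), `|x - p| <= r%:R -> `|y - p| <= r%:R ->
    `|x - y| <= (omega r k).+1%:R^-1 -> `|P x - P y| <= k.+1%:R^-1.

End operators.

Definition chi (B k : nat) : nat :=
  (`|Num.ceil (2^-1 * (B%:R + 1) ^+ 2 + 1 : rat)| * k.+1)%N.

(* Omega_s(k), with K standing for K_{s,k}. *)
Definition Omega_at (Omega : nat -> (nat -> nat) -> nat -> nat) (B K k : nat) : nat :=
  chi B (Omega K id (3 * k + 2)%N).

(* Main.v *)
(* Let [x] be close to [u s], [s] the rate [s*], and follow the implicit Euler scheme
   [x_i = (Id + l A)^-i x] instead of the orbit [S(t) x].  Each step lowers half the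
   squared distance to the zeros of [A] by at least [l <y_i, J (x_i - P x_i)>], up to
   an error that is negligible for small [l] because [P] and [J] are uniformly
   continuous on bounded sets.  That distance being at most [B + 1], some [x_i] with
   [i l <= chi n] has pairing at most [1 / (n + 1)]; the summand 1 in [chi] absorbs
   the error.  Kobayashi's estimate for two Euler schemes shows that the limit
   defining [S(t)] exists and that [x_i] is close to [S(i l) x].  The weak modulus,
   applied to these points for all [n], yields one of them close to a zero [q].
   Then [u] is close to [q] at the corresponding time [T >= s*], hence at all later
   times, since [S(t)] is nonexpansive, fixes [q], and [u] is an almost-orbit. *)

Require Import Defs.
From HB Require Import structures.
From mathcomp Require Import all_boot all_order all_algebra.
From mathcomp Require Import all_classical all_reals all_analysis.
From mathcomp Require Import ring lra.
Import Order.TTheory GRing.Theory Num.Theory.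
Import numFieldNormedType.Exports.
Local Open Scope classical_set_scope.
Local Open Scope ring_scope.

(** * The one-sided directional derivative of the norm *)

Section NormDerivative.
Context {R : realType} {X : normedModType R}.

Lemma uniformly_smooth_scaled (e : R) : uniformly_smooth X -> 0 < e ->
  exists2 d : R, 0 < d & forall x y : X, `|y| <= d * `|x| ->
    `|x + y| + `|x - y| <= 2 * `|x| + e * `|y|.
Proof.
move=> hs /hs[d d0 hd]; exists d => // x y.
have [->|x0 hy] := eqVneq x 0.
  by rewrite normr0 mulr0 normr_le0 => /eqP ->; rewrite subr0 addr0 normr0; lra.
have nx0 : 0 < `|x| by rewrite normr_gt0.
have := hd (`|x|^-1 *: x) (`|x|^-1 *: y).
rewrite -scalerDr -scalerBr !normrZ ger0_norm ?invr_ge0// mulVf ?gt_eqF//.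
move=> /(_ erefl); rewrite ler_pdivrMl// mulrC => /(_ hy).
by rewrite -mulrDr ler_pdivrMl// mulrDr mulrCA mulVKf ?gt_eqF// mulrC; lra.
Qed.

Definition norm_slopes (x y : X) : set R :=
  [set (`|x + t *: y| - `|x|) / t | t in [set t : R | 0 < t]].

(** This is the right Gateaux derivative of the norm at [x] in direction [y]: by convexity the
    slopes decrease with the step, so their limit at 0+ is their infimum. *)
Definition norm_deriv (x y : X) : R := inf (norm_slopes x y).

Lemma norm_slopes_ge (x y : X) (t : R) : 0 < t ->
  - `|y| <= (`|x + t *: y| - `|x|) / t.
Proof.
move=> t0; rewrite ler_pdivlMr//.
have := ler_normB (x + t *: y) (t *: y).
by rewrite addrK normrZ (gtr0_norm t0); lra.
Qed.

Lemma has_inf_norm_slopes (x y : X) : has_inf (norm_slopes x y).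
Proof.
split; first by exists ((`|x + 1 *: y| - `|x|) / 1), 1 => //=; exact: ltr01.
by exists (- `|y|) => _ [t t0 <-]; exact: norm_slopes_ge.
Qed.

Lemma norm_deriv_le_slope (x y : X) (t : R) : 0 < t ->
  norm_deriv x y <= (`|x + t *: y| - `|x|) / t.
Proof.
move=> t0; apply: ge_inf; first by have [] := has_inf_norm_slopes x y.
by exists t.
Qed.

Lemma norm_deriv_ge (x y : X) (c : R) :
  (forall t : R, 0 < t -> c <= (`|x + t *: y| - `|x|) / t) -> c <= norm_deriv x y.
Proof.
move=> h; apply: lb_le_inf; first by have [] := has_inf_norm_slopes x y.
by move=> _ [t t0 <-]; exact: h.
Qed.

Lemma norm_deriv_self (x : X) : norm_deriv x x = `|x|.
Proof.
have slope (t : R) : 0 < t -> (`|x + t *: x| - `|x|) / t = `|x|.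
  move=> t0; rewrite -{1}[x]scale1r -scalerDl normrZ ger0_norm; last by lra.
  by field; lra.
apply/le_anti/andP; split.
  by have := norm_deriv_le_slope x x 1 ltr01; rewrite slope.
by apply: norm_deriv_ge => t /slope ->.
Qed.

Lemma norm_deriv_le (x y : X) : norm_deriv x y <= `|y|.
Proof.
apply: le_trans (norm_deriv_le_slope x y 1 ltr01) _.
by rewrite divr1 scale1r; have := ler_normD x y; lra.
Qed.

(* The step [t = t1 t2 / (t1 + t2)] makes [x + t (y + z)] the convex combination
   of [x + t1 y] and [x + t2 z] with weights [t / t1] and [t / t2]. *)
Lemma norm_derivD_le (x y z : X) :
  norm_deriv x (y + z) <= norm_deriv x y + norm_deriv x z.
Proof.
rewrite -lerBlDr; apply: norm_deriv_ge => t1 t10.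
rewrite lerBlDr -lerBlDl; apply: norm_deriv_ge => t2 t20; rewrite lerBlDl.
pose t : R := t1 * t2 / (t1 + t2).
have t0 : 0 < t by rewrite divr_gt0 ?mulr_gt0 ?addr_gt0.
apply: le_trans (norm_deriv_le_slope x _ t t0) _.
have -> : x + t *: (y + z) =
    (t / t1) *: (x + t1 *: y) + (t / t2) *: (x + t2 *: z).
  rewrite !scalerDr !scalerA !divfK ?gt_eqF// addrACA -scalerDl.
  rewrite (_ : t / t1 + t / t2 = 1) ?scale1r//.
  by rewrite /t; field; lra.
rewrite ler_pdivrMr// lerBlDr.
apply: le_trans (ler_normD _ _) _.
rewrite (normrZ (t / t1)) (normrZ (t / t2)) (gtr0_norm (divr_gt0 t0 t10))
  (gtr0_norm (divr_gt0 t0 t20)).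
rewrite le_eqVlt; apply/orP; left; apply/eqP.
by rewrite /t; field; lra.
Qed.

Lemma norm_deriv0 (x : X) : norm_deriv x 0 = 0.
Proof.
apply/le_anti/andP; split; first by have := norm_deriv_le x 0; rewrite normr0.
by apply: norm_deriv_ge => t t0; rewrite scaler0 addr0 subrr mul0r.
Qed.

Lemma norm_deriv_posZ (x y : X) (c : R) : 0 < c ->
  norm_deriv x (c *: y) = c * norm_deriv x y.
Proof.
move=> c0; apply/le_anti/andP; split.
  rewrite mulrC -ler_pdivrMr//; apply: norm_deriv_ge => t t0.
  rewrite ler_pdivrMr//.
  apply: le_trans (norm_deriv_le_slope x _ _ (divr_gt0 t0 c0)) _.
  by rewrite scalerA divfK ?gt_eqF// invf_div mulrA mulrAC.
apply: norm_deriv_ge => t t0; rewrite -ler_pdivlMl//.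
apply: le_trans (norm_deriv_le_slope x _ _ (mulr_gt0 t0 c0)) _.
by rewrite scalerA invfM mulrA [leRHS]mulrC.
Qed.

(** Smoothness turns the sublinear [norm_deriv x] into a linear functional: for a small step the
    slopes in directions [y] and [- y] have sum at most [e]. The other inequality is
    subadditivity. *)
Lemma norm_derivN (x y : X) : uniformly_smooth X -> x != 0 ->
  norm_deriv x (- y) = - norm_deriv x y.
Proof.
move=> hs x0; apply/le_anti/andP; split; last first.
  by have := norm_derivD_le x y (- y); rewrite subrr norm_deriv0; lra.
apply/ler_addgt0Pl => e e0.
have nx0 : 0 < `|x| by rewrite normr_gt0.
have ny0 : 0 < `|y| + 1 by rewrite ltr_wpDl.
have [d d0 hd] := uniformly_smooth_scaled (e / (`|y| + 1)) hs (divr_gt0 e0 ny0).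
(* This step gives [|t *: y| <= d * |x|], as smoothness at [x] requires; the summand 1 keeps the
   denominator positive when [y = 0]. *)
pose t := d * `|x| / (`|y| + 1).
have t0 : 0 < t by rewrite divr_gt0 ?mulr_gt0.
have hty : `|t *: y| <= d * `|x|.
  rewrite normrZ (gtr0_norm t0) /t mulrAC ler_pdivrMr//.
  by rewrite ler_wpM2l// ?lerDl// mulr_ge0// ltW.
have := hd x (t *: y) hty.
have := norm_deriv_le_slope x y t t0; have := norm_deriv_le_slope x (- y) t t0.
rewrite !ler_pdivlMr// scalerN normrZ (gtr0_norm t0) => h1 h2 h3.
rewrite -(ler_pM2r t0).
have : e / (`|y| + 1) * (t * `|y|) <= e * t.
  by rewrite mulrAC ler_pdivrMr// -!mulrA !ler_pM2l// lerDl.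
lra.
Qed.

Lemma norm_derivD (x y z : X) : uniformly_smooth X -> x != 0 ->
  norm_deriv x (y + z) = norm_deriv x y + norm_deriv x z.
Proof.
move=> hs x0; apply/le_anti; rewrite norm_derivD_le/=.
by have := norm_derivD_le x (y + z) (- z); rewrite addrK norm_derivN//; lra.
Qed.

Lemma norm_derivZ (x y : X) (c : R) : uniformly_smooth X -> x != 0 ->
  norm_deriv x (c *: y) = c * norm_deriv x y.
Proof.
move=> hs x0; have [c0|c0|->] := ltgtP c 0.
- have := norm_deriv_posZ x y (- c); rewrite oppr_gt0 => /(_ c0).
  by rewrite scaleNr norm_derivN// mulNr => /oppr_inj.
- by rewrite norm_deriv_posZ.
- by rewrite scale0r norm_deriv0 mul0r.
Qed.

Lemma abs_norm_deriv_le (x y : X) : uniformly_smooth X -> x != 0 ->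
  `|norm_deriv x y| <= `|y|.
Proof.
move=> hs x0; rewrite ler_norml norm_deriv_le andbT lerNl -norm_derivN//.
by rewrite -(normrN y) norm_deriv_le.
Qed.

End NormDerivative.

(** * The duality map and its uniform continuity on bounded sets *)

Section Duality.
Context {R : realType} {X : completeNormedModType R}.
Hypothesis smoothX : uniformly_smooth X.

(** The supremum in [dual_norm] is meaningful only on a bounded set; continuity at 0 supplies the
    bound [2 / d] on the unit ball. *)
Lemma le_dual_norm (f : X -> R) (y : X) : linear (f : X -> R^o) -> continuous f ->
  `|f y| <= dual_norm f * `|y|.
Proof.
move=> flin fcont.
have f0 : f 0 = 0 by have := flin (-1) 0 0; rewrite scaler0 addr0 scaleN1r addNr.
have fZ (c : R) (z : X) : f (c *: z) = c * f z.
  by rewrite -[c *: z]addr0 flin f0 addr0.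
have bounded : has_ubound [set `|f x| | x in [set x | `|x| <= 1]].
  have /cvgrPdist_lt/(_ 1 ltr01)/nbhs_normP[d /= d0 hd] := fcont 0.
  exists (2 / d) => _ [x /= x1 <-].
  have := hd (d / 2 *: x); rewrite /= sub0r f0 sub0r !normrN fZ normrM normrZ.
  rewrite gtr0_norm ?divr_gt0// ler_pdivlMr// => h.
  have /h : d / 2 * `|x| < d.
    by apply: le_lt_trans (_ : d / 2 * 1 < d); [rewrite ler_pM2l ?divr_gt0|lra].
  by lra.
have [->|y0] := eqVneq y 0; first by rewrite f0 !normr0 mulr0.
have ny0 : 0 < `|y| by rewrite normr_gt0.
rewrite -ler_pdivrMr//; apply: ub_le_sup => //.
exists (`|y|^-1 *: y); rewrite /= ?normrZ ?fZ ?normrM gtr0_norm ?invr_gt0//.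
  by rewrite mulVf ?gt_eqF.
by rewrite mulrC.
Qed.

(** For [x != 0] the derivative of half the squared norm, [|x| * norm_deriv x], is a member, so
    Hahn-Banach is avoided. This gives the element chosen by [xget] in [J] its defining
    properties. *)
Lemma duality_set_nonempty (x : X) : duality_set x !=set0.
Proof.
have [->|x0] := eqVneq x 0.
  exists (fun=> 0); split.
  - by move=> c y z; rewrite scaler0 addr0.
  - exact: cst_continuous.
  - by rewrite normr0 expr0n.
  - rewrite normr0; apply: etrans (sup1 (0 : R)); congr sup.
    apply/seteqP; split=> [_ [y _ <-]|_ ->]/=; first by rewrite normr0.
    by exists 0; rewrite normr0.
have nx0 : 0 < `|x| by rewrite normr_gt0.
exists (fun y => `|x| * norm_deriv x y); split.
- by move=> c y z; rewrite norm_derivD// norm_derivZ// mulrDr mulrCA.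
- move=> y; apply/cvgrPdist_le => e e0.
  apply/nbhs_normP; exists (e / `|x|); rewrite /= ?divr_gt0// => z /= hz.
  rewrite -mulrBr -norm_derivN// -norm_derivD// normrM normr_id.
  rewrite -ler_pdivlMl// mulrC.
  by apply: le_trans (abs_norm_deriv_le _ _ smoothX x0) (ltW hz).
- by rewrite norm_deriv_self expr2.
- apply/le_anti/andP; split.
    apply: ge_sup; first by exists (`| `|x| * norm_deriv x 0|), 0; rewrite //= normr0.
    move=> _ [y /= y1 <-]; rewrite normrM normr_id ler_piMr//.
    by apply: le_trans (abs_norm_deriv_le _ _ smoothX x0) y1.
  apply: ub_le_sup.
    exists (`|x|) => _ [y /= y1 <-]; rewrite normrM normr_id ler_piMr//.
    by apply: le_trans (abs_norm_deriv_le _ _ smoothX x0) y1.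
  exists (`|x|^-1 *: x) => /=.
    by rewrite normrZ gtr0_norm ?invr_gt0// mulVf ?gt_eqF.
  by rewrite norm_derivZ// norm_deriv_self mulVf ?gt_eqF// mulr1 normr_id.
Qed.

Lemma J_duality_set (x : X) : duality_set x (J x).
Proof. exact: (xgetPex _ (duality_set_nonempty x)). Qed.

Lemma pairing_linear (x y z : X) (c : R) :
  pairing (c *: y + z) x = c * pairing y x + pairing z x.
Proof. by have [h _ _ _] := J_duality_set x; exact: h. Qed.

Lemma pairingD (x y z : X) : pairing (y + z) x = pairing y x + pairing z x.
Proof. by have := pairing_linear x y z 1; rewrite scale1r mul1r. Qed.

Lemma pairing0l (x : X) : pairing 0 x = 0.
Proof. by have := pairingD x 0 0; rewrite addr0; lra. Qed.

Lemma pairingZ (x y : X) (c : R) : pairing (c *: y) x = c * pairing y x.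
Proof. by have := pairing_linear x y 0 c; rewrite !addr0 pairing0l addr0. Qed.

Lemma pairingN (x y : X) : pairing (- y) x = - pairing y x.
Proof. by rewrite -scaleN1r pairingZ mulN1r. Qed.

Lemma pairing_self (x : X) : pairing x x = `|x| ^+ 2.
Proof. by have [] := J_duality_set x. Qed.

Lemma abs_pairing_le (x y : X) : `|pairing y x| <= `|x| * `|y|.
Proof.
by have [flin fcont _ <-] := J_duality_set x; exact: (le_dual_norm (J x)).
Qed.

Lemma pairing_le (x y : X) : pairing y x <= `|x| * `|y|.
Proof. by rewrite (le_trans (ler_norm _))// abs_pairing_le. Qed.

(* [y |-> <y, J b>] is a subgradient of half the squared norm at [b]. *)
Lemma half_sqr_norm_subgradient (b h : X) :
  2^-1 * `|b| ^+ 2 + pairing h b <= 2^-1 * `|b + h| ^+ 2.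
Proof.
have := pairing_le b (b + h); rewrite pairingD pairing_self.
by have := sqr_ge0 (`|b| - `|b + h|); rewrite sqrrB; lra.
Qed.

(* Adding [<a + h, J a> <= |a| |a + h|] and [<a - h, J b> <= |b| |a - h|] and using
   smoothness at [a] bounds [<h, J a - J b>]. *)
Lemma pairing_diff_le (e d : R) (a b h : X) :
  `|a + h| + `|a - h| <= 2 * `|a| + e * `|h| -> `|a - b| <= d -> d <= 1 ->
  pairing h a - pairing h b <= e * `|a| * `|h| + d * (4 * `|a| + 2 + `|h|).
Proof.
move=> hsm hd d1.
have d0 : 0 <= d by apply: le_trans hd.
have := pairing_le a (a + h); have := pairing_le b (a - h).
rewrite !pairingD pairingN pairing_self => h1 h2.
have := abs_pairing_le b (a - b); rewrite pairingD pairingN pairing_self ler_norml.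
move=> /andP[h3 _].
have nb : `|b| <= `|a| + d.
  by have := ler_dist_dist a b; rewrite ler_norml => /andP[]; lra.
have na : `|a| <= `|b| + d by have := ler_dist_dist a b; rewrite ler_norml => /andP[]; lra.
have h4 : `|b| * `|a - b| <= `|b| * d by rewrite ler_wpM2l.
have h5 : `|a - h| <= `|a| + `|h| by exact: ler_normB.
have h6 : `|b| * `|a - h| <= (`|a| + d) * `|a - h| by rewrite ler_wpM2r.
have h7 : `|a| * (`|a + h| + `|a - h|) <= `|a| * (2 * `|a| + e * `|h|).
  by rewrite ler_wpM2l.
have h8 : d * `|a - h| <= d * (`|a| + `|h|) by rewrite ler_wpM2l.
have h9 : d * `|b| <= d * (`|a| + 1) by rewrite ler_wpM2l//; lra.
have h10 : `|a| ^+ 2 - `|b| ^+ 2 <= d * (`|a| + `|b|).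
  by rewrite subr_sqr ler_wpM2r ?addr_ge0//; lra.
by rewrite !expr2 in h3 h2 h10; lra.
Qed.

(** Smoothness at [a] controls only increments that are small relative to [|a|]. Near 0 both
    pairings are small by themselves; away from 0 the estimate [pairing_diff_le] is applied to
    [c *: y] and divided by [c]. *)
Lemma pairing_unif_continuous (r M e : R) : 0 < r -> 0 < M -> 0 < e ->
  exists2 d : R, 0 < d & forall a b y : X, `|a| <= r -> `|y| <= M -> `|a - b| <= d ->
    `|pairing y a - pairing y b| <= e.
Proof.
move=> r0 M0 e0.
have [d1 d10 hd1] := uniformly_smooth_scaled (e / (2 * r * M)) smoothX
  (divr_gt0 e0 (mulr_gt0 (mulr_gt0 (ltr0Sn _ _) r0) M0)).
(* If [|a| <= n], then [|b| <= 2 * n] and the two pairings sum to at most [3 * n * M < e]. If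
   [|a| > n], the identity [c * M = d1 * n] makes [c *: y] an admissible increment, and the two
   error terms are at most [c * e / 2] each. *)
pose n : R := e / (4 * M); have n0 : 0 < n by rewrite divr_gt0// mulr_gt0.
pose c : R := d1 * n / M; have c0 : 0 < c by rewrite divr_gt0// mulr_gt0.
pose C : R := 4 * r + 2 + c * M.
have C0 : 0 < C by rewrite !addr_gt0// mulr_gt0.
pose d : R := Num.min 1 (Num.min n (e * c / (2 * C))).
have d_1 : d <= 1 by rewrite ge_min lexx.
have d_n : d <= n by rewrite !ge_min lexx orbT.
have d_c : d <= e * c / (2 * C) by rewrite !ge_min lexx !orbT.
have d0 : 0 < d by rewrite !lt_min ltr01 n0/= (divr_gt0 (mulr_gt0 e0 c0))// mulr_gt0.
exists d => // a b; clearbody d.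
suff main (y : X) : `|a| <= r -> `|y| <= M -> `|a - b| <= d ->
    pairing y a - pairing y b <= e.
  move=> y ar yM ab; rewrite ler_norml main// andbT.
  by have := main (- y) ar; rewrite normrN !pairingN => /(_ yM ab); lra.
move=> ar yM ab.
have [an|an] := leP `|a| n.
  have nb : `|b| <= 2 * n.
    by have := ler_dist_dist a b; rewrite ler_norml => /andP[]; lra.
  have := pairing_le a y; have := pairing_le b (- y); rewrite pairingN normrN.
  have : `|a| * `|y| <= n * M by rewrite ler_pM.
  have : `|b| * `|y| <= 2 * n * M by rewrite ler_pM.
  have : n * M = e / 4 by rewrite /n; field; lra.
  by lra.
have hcy : `|c *: y| <= c * M by rewrite normrZ gtr0_norm// ler_pM2l.
have := hd1 a (c *: y); have hca : `|c *: y| <= d1 * `|a|.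
  by apply: le_trans hcy _; rewrite /c divfK ?gt_eqF// ler_pM2l// ltW.
move=> /(_ hca) /pairing_diff_le/(_ ab d_1).
rewrite !pairingZ -mulrBr.
have : e / (2 * r * M) * `|a| * `|c *: y| <= e / (2 * r * M) * r * (c * M).
  have E0 : 0 <= e / (2 * r * M) by rewrite ltW// divr_gt0// !mulr_gt0.
  by apply: ler_pM => //; [exact: mulr_ge0|exact: ler_wpM2l].
have -> : e / (2 * r * M) * r * (c * M) = c * (e / 2).
  by field; lra.
have : d * (4 * `|a| + 2 + `|c *: y|) <= e * c / (2 * C) * C.
  have hC : 4 * `|a| + 2 + `|c *: y| <= C by rewrite /C; lra.
  by apply: ler_pM => //; exact: ltW.
have -> : e * c / (2 * C) * C = c * (e / 2) by field; lra.
move=> h1 h2 h3; rewrite -(ler_pM2l c0); lra.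
Qed.

End Duality.

(** * Nearest points and strict convexity in uniformly convex spaces *)

Section UniformlyConvex.
Context {R : realType} {X : completeNormedModType R}.

Lemma cauchy_seq_cvg (v : nat -> X) :
  (forall e : R, 0 < e -> exists N, forall n, (N <= n)%N -> `|v N - v n| < e) ->
  cvg (v @ \oo).
Proof.
move=> hv; apply/cauchy_cvgP/cauchy_exP => e /hv[N hN].
by exists (v N); exists N => // n /= Nn; rewrite -ball_normE; exact: hN.
Qed.

Lemma cvg_dist_le (v w : nat -> X) (a b : X) (c : R) : v n @[n --> \oo] --> a ->
  w n @[n --> \oo] --> b -> (\forall n \near \oo, `|v n - w n| <= c) -> `|a - b| <= c.
Proof. by move=> va wb; apply: cvgr_to_le (cvg_norm (cvgB va wb)). Qed.

Lemma archimedean_nat (c e : R) : 0 < e -> exists N : nat, (0 < N)%N /\ c / N%:R < e.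
Proof.
move=> e0; exists (Num.trunc (c / e)).+1; split => //.
by rewrite ltr_pdivrMr// mulrC -ltr_pdivrMr// truncnS_gt.
Qed.

Lemma half_scale_double (x : X) : 2^-1 *: (x + x) = x.
Proof.
by rewrite -mulr2n -(scaler_nat 2 x) scalerA mulVf ?scale1r// pnatr_eq0.
Qed.

Hypothesis convexX : uniformly_convex X.

Lemma uniformly_convex_scaled (e : R) : 0 < e -> exists2 d : R, 0 < d &
  forall (r : R) (x y : X), 0 < r -> `|x| <= r -> `|y| <= r -> e * r <= `|x - y| ->
    `|2^-1 *: (x + y)| <= (1 - d) * r.
Proof.
move=> /convexX[d d0 hd]; exists d => // r x y r0 xr yr exy.
have := hd (r^-1 *: x) (r^-1 *: y).
rewrite -scalerBr -scalerDr !normrZ (gtr0_norm (x := r^-1)) ?invr_gt0//.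
rewrite !ler_pdivrMl ?mulr1// ler_pdivlMl// mulrC => /(_ xr yr exy).
by rewrite mulrCA ler_pdivrMl// [r * _]mulrC.
Qed.

Definition midpoint_convex (C : set X) :=
  forall x y, C x -> C y -> C (2^-1 *: (x + y)).

Definition seq_closed (C : set X) :=
  forall (v : nat -> X) x, (forall n, C (v n)) -> v n @[n --> \oo] --> x -> C x.

(** A minimizing sequence is Cauchy: if two late terms were far apart, uniform convexity would put
    their midpoint, which lies in [C], closer to [x] than the infimum [d]. *)
Lemma nearest_points_nonempty (C : set X) (x : X) : C !=set0 -> seq_closed C ->
  midpoint_convex C -> nearest_points C x !=set0.
Proof.
move=> [c0 Cc0] Ccl Cmid.
pose D : set R := [set `|x - z| | z in C].
have D0 : D !=set0 by exists `|x - c0|, c0.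
have lbD : has_lbound D by exists 0 => _ [z _ <-].
pose d := inf D.
have dle z : C z -> d <= `|x - z| by move=> Cz; apply: ge_inf => //; exists z.
have d0 : 0 <= d by apply: lb_le_inf => // _ [z _ <-].
have ex n : exists z, C z /\ `|x - z| < d + n.+1%:R^-1.
  have n0 : 0 < (n.+1%:R : R)^-1 by rewrite invr_gt0.
  have [_ [z Cz <-] hz] := inf_adherent n0 (conj D0 lbD).
  by exists z.
have [v hv] := choice ex.
have vC n : C (v n) by case: (hv n).
suff /cvg_ex[q vq] : cvg (v @ \oo).
  exists q; split; first exact: Ccl vq.
  move=> z /dle; apply: le_trans; apply/ler_addgt0Pl => e e0.
  apply: (@cvg_dist_le (cst x) v) => //; first exact: cvg_cst.
  have [N [N0 hN]] := archimedean_nat 1 e e0.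
  exists N => // n /= Nn; apply: (le_trans (ltW (hv n).2)).
  rewrite addrC lerD2r; apply: le_trans (ltW hN); rewrite div1r lef_pV2 ?posrE ?ltr0n//.
  by rewrite ler_nat ltnW.
apply: cauchy_seq_cvg => e e0.
(* The radii [r] used below are at most [d + 1], so a separation of [e] is at least [e' * r]. *)
pose e' := e / (d + 1); have e'0 : 0 < e' by rewrite divr_gt0//; lra.
have [k k0 hk] := uniformly_convex_scaled _ e'0.
(* For [d > 0] the choice [h = k * d] makes [d <= (1 - k) * r] contradictory. For [d = 0] there is
   no contradiction, but two points within [r < e / 2] of [x] are less than [e] apart. *)
have dr : exists2 h : R, 0 < h & forall r : R, d < r -> r < d + h -> r <= d + 1 ->
    d <= (1 - k) * r -> 2 * r < e.
  have [dz|dn0] := eqVneq d 0.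
    by exists (e / 2) => [|r]; rewrite ?divr_gt0// dz; lra.
  have dp : 0 < d by rewrite lt_def dn0.
  exists (k * d); first exact: mulr_gt0.
  move=> r dr hr r1; have : k * d < k * r by rewrite ltr_pM2l.
  lra.
have [h h0 hh] := dr; have [N [N0 hN]] := archimedean_nat 1 h h0.
exists N => n Nn; rewrite ltNge; apply/negP => hvn.
pose r := d + N.+1%:R^-1.
have iN : 0 < (N.+1%:R : R)^-1 by rewrite invr_gt0.
have iN1 : (N.+1%:R : R)^-1 <= 1 by rewrite invf_le1 ?ler1n.
have iNN : (N.+1%:R : R)^-1 < N%:R^-1 by rewrite ltf_pV2 ?posrE ?ltr0n// ltr_nat.
have xN : `|x - v N| <= r by exact/ltW/(hv N).2.
have xn : `|x - v n| <= r.
  apply: (le_trans (ltW (hv n).2)).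
  by rewrite lerD2l lef_pV2 ?posrE ?ltr0n// ler_nat ltnS.
have vv : `|(x - v n) - (x - v N)| = `|v N - v n|.
  by rewrite opprB addrC addrA subrK.
have e'r : e' * r <= `|(x - v n) - (x - v N)|.
  rewrite vv; apply: le_trans hvn.
  rewrite /e' mulrAC ler_pdivrMr ?ltr_wpDl//.
  by rewrite ler_pM2l// lerD2l.
have dr' : d < r by rewrite ltrDl.
have r0 : 0 < r by exact: le_lt_trans d0 dr'.
have rh : r < d + h by rewrite ltrD2l; apply: lt_trans iNN _; rewrite -div1r.
have r1 : r <= d + 1 by rewrite lerD2l.
have := hk r _ _ r0 xn xN e'r; have := dle _ (Cmid _ _ (vC n) (vC N)).
have -> : 2^-1 *: (x - v n + (x - v N)) = x - 2^-1 *: (v n + v N).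
  by rewrite addrACA -opprD scalerBr half_scale_double.
move=> h1 h2; have : 2 * r < e by apply: hh => //; exact: le_trans h2.
have := ler_normB (x - v n) (x - v N); rewrite vv; lra.
Qed.

(** If [w] and [q] differed, their midpoint would be at distance less than [r] from both [x] and
    [y], against [|x - y| = 2 * r]. *)
Lemma strict_convexity (r : R) (x y w q : X) : `|w - x| <= r -> `|q - x| <= r ->
  `|w - y| <= r -> `|q - y| <= r -> `|x - y| = 2 * r -> w = q.
Proof.
move=> wx qx wy qy xy; apply/eqP; rewrite -subr_eq0 -normr_le0 leNgt; apply/negP => wq.
have : `|w - q| <= 2 * r.
  rewrite -(subrK x w) -addrA; apply: le_trans (ler_normD _ _) _.
  by rewrite [`|x - q|]distrC; lra.
move=> wqr; have r0 : 0 < r by lra.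
have [k k0 hk] := uniformly_convex_scaled _ (divr_gt0 wq r0).
have mid z : `|w - z| <= r -> `|q - z| <= r ->
    `|2^-1 *: (w + q) - z| <= (1 - k) * r.
  move=> wz qz; have := hk r (w - z) (q - z) r0 wz qz.
  rewrite opprB addrA subrK divfK ?gt_eqF// lexx => /(_ isT).
  by rewrite addrACA -opprD scalerBr half_scale_double.
have := ler_distD (2^-1 *: (w + q)) x y.
rewrite xy [`|x - _|]distrC; have := mid x wx qx; have := mid y wy qy.
by have := mulr_gt0 k0 r0; lra.
Qed.

End UniformlyConvex.

(** * Resolvents, the exponential formula and the set of zeros *)

Section Semigroup.
Context {R : realType} {X : completeNormedModType R}.
Hypothesis smoothX : uniformly_smooth X.
Variable A : X -> set X.
Hypothesis mA : m_accretive A.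

(** Pairing the right-hand difference with [J (x1 - x2)] gives [|x1 - x2| ^+ 2] plus a term that is
    nonnegative by accretivity. *)
Lemma accretive_dist_le (g : R) (x1 y1 x2 y2 : X) : 0 <= g -> A x1 y1 -> A x2 y2 ->
  `|x1 - x2| <= `|x1 + g *: y1 - (x2 + g *: y2)|.
Proof.
move=> g0 h1 h2; have h := mA.1 _ _ _ _ h1 h2.
set z := x1 - x2 in h *; set w := _ - (x2 + _).
have [->|z0] := eqVneq z 0; first by rewrite normr0.
have nz : 0 < `|z| by rewrite normr_gt0.
rewrite -(ler_pM2l nz) -expr2 -(pairing_self smoothX).
apply: le_trans (pairing_le smoothX z w).
have -> : w = z + g *: (y1 - y2) by rewrite /w /z scalerBr opprD addrACA.
by rewrite (pairingD smoothX) (pairingZ smoothX) lerDl mulr_ge0.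
Qed.

Lemma resolventP (g : R) (z : X) : 0 < g ->
  A (resolvent A g z) (g^-1 *: (z - resolvent A g z)).
Proof.
move=> g0.
have [x [y [xy zE]]] : range_Id_plus A g z by rewrite (mA.2 g g0).
have [y' xy' zE'] : [set x | exists2 y, A x y & z = x + g *: y] (resolvent A g z).
  by apply: xgetPex; exists x, y.
by rewrite [X in X - _]zE' addrAC subrr add0r scalerA mulVf ?gt_eqF// scale1r.
Qed.

Lemma resolvent_eq (g : R) (x y : X) : 0 < g -> A x y -> resolvent A g (x + g *: y) = x.
Proof.
move=> g0 xy; apply/eqP; rewrite -subr_eq0 -normr_le0.
apply: le_trans (accretive_dist_le _ _ _ _ _ (ltW g0) (resolventP _ _ g0) xy) _.
by rewrite scalerA mulfV ?gt_eqF// scale1r [resolvent _ _ _ + _]addrC subrK subrr normr0.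
Qed.

(** Outside [dom A] this rests on the default [z] of [xget]. It lets nonexpansiveness hold for all
    [0 <= g], which covers [t = 0] and the term [n = 0], where [t / n%:R] is 0. *)
Lemma resolvent0 (z : X) : resolvent A 0 z = z.
Proof.
rewrite /resolvent; case: xgetP => //= x _ [y _ ->].
by rewrite scale0r addr0.
Qed.

Lemma resolvent_nonexpansive (g : R) (z w : X) : 0 <= g ->
  `|resolvent A g z - resolvent A g w| <= `|z - w|.
Proof.
rewrite le_eqVlt => /orP[/eqP <-|g0]; first by rewrite !resolvent0.
have := accretive_dist_le _ _ _ _ _ (ltW g0) (resolventP g z g0) (resolventP g w g0).
by rewrite !scalerA mulfV ?gt_eqF// !scale1r ![resolvent _ _ _ + _]addrC !subrK.
Qed.

Lemma iter_resolvent_nonexpansive (g : R) (n : nat) (z w : X) : 0 <= g ->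
  `|iter n (resolvent A g) z - iter n (resolvent A g) w| <= `|z - w|.
Proof.
move=> g0; elim: n => //= n; apply: le_trans; exact: resolvent_nonexpansive.
Qed.

Lemma resolvent_zero (g : R) (p : X) : 0 <= g -> zeros A p -> resolvent A g p = p.
Proof.
rewrite le_eqVlt => /orP[/eqP <-|g0]; first by rewrite resolvent0.
by move=> /(resolvent_eq _ _ _ g0); rewrite scaler0 addr0.
Qed.

Lemma iter_resolvent_zero (g : R) (n : nat) (p : X) : 0 <= g -> zeros A p ->
  iter n (resolvent A g) p = p.
Proof. by move=> g0 hp; elim: n => //= n ->; exact: resolvent_zero. Qed.

(** As [x] is the resolvent of [x + g *: y], the first step has length at most [g * |y|], and
    nonexpansiveness prevents later steps from being longer. *)
Lemma iter_resolvent_step (g : R) (n : nat) (x y : X) : 0 < g -> A x y ->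
  `|iter n (resolvent A g) x - iter n.+1 (resolvent A g) x| <= g * `|y|.
Proof.
move=> g0 xy; elim: n => [|n IH] /=.
  rewrite -{1}(resolvent_eq g x y g0 xy).
  apply: le_trans (resolvent_nonexpansive _ _ _ (ltW g0)) _.
  by rewrite addrAC subrr add0r normrZ gtr0_norm.
by apply: le_trans IH; apply: resolvent_nonexpansive; exact: ltW.
Qed.

Lemma iter_resolvent_dist (g : R) (n : nat) (x y : X) : 0 < g -> A x y ->
  `|iter n (resolvent A g) x - x| <= n%:R * g * `|y|.
Proof.
move=> g0 xy; elim: n => [|n IH]; first by rewrite subrr normr0 !mul0r.
have := iter_resolvent_step g n x y g0 xy; rewrite distrC => h.
have := ler_distD (iter n (resolvent A g) x) (iter n.+1 (resolvent A g) x) x.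
by rewrite -natr1; lra.
Qed.

(** Accretivity at the two resolvent points [a] and [b], multiplied by [l * m], bounds
    [(l + m) * |a - b| ^+ 2] by pairings of [a - w] and [z - b] with [J (a - b)]. *)
Lemma resolvent_dist_le (l m : R) (z w : X) : 0 < l -> 0 < m ->
  (l + m) * `|resolvent A l z - resolvent A m w| <=
  l * `|resolvent A l z - w| + m * `|z - resolvent A m w|.
Proof.
move=> l0 m0; set a := resolvent A l z; set b := resolvent A m w.
have [->|h0] := eqVneq (a - b) 0.
  by rewrite normr0 mulr0 addr_ge0// mulr_ge0// ltW.
have nh : 0 < `|a - b| by rewrite normr_gt0.
have pB (x y : X) : pairing (x - y) (a - b) = pairing x (a - b) - pairing y (a - b).
  by rewrite (pairingD smoothX) (pairingN smoothX).
have := mA.1 _ _ _ _ (resolventP l z l0) (resolventP m w m0).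
rewrite -/a -/b pB !(pairingZ smoothX) !pB => acc.
have : 0 <= m * (pairing z (a - b) - pairing a (a - b)) -
            l * (pairing w (a - b) - pairing b (a - b)).
  rewrite -[X in 0 <= X](mulVKf (x := l * m)) ?mulf_neq0 ?gt_eqF//.
  apply: mulr_ge0; first by rewrite mulr_ge0// ltW.
  by apply: le_trans acc _; rewrite le_eqVlt; apply/orP; left; apply/eqP; field; lra.
have := pairing_self smoothX (a - b); rewrite pB => e1.
have := pairing_le smoothX (a - b) (a - w); rewrite pB => /(ler_wpM2l (ltW l0)) e2.
have := pairing_le smoothX (a - b) (z - b); rewrite pB => /(ler_wpM2l (ltW m0)) e3.
move=> e4; rewrite -(ler_pM2l nh).
have : (l + m) * `|a - b| ^+ 2 = `|a - b| * ((l + m) * `|a - b|) by ring.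
rewrite -e1; lra.
Qed.

(* Kobayashi's estimate: the right-hand side is exactly preserved by the recursion
   coming from [resolvent_dist_le]. *)
Lemma iter_resolvent_dist_sqr (l m : R) (i j : nat) (x y : X) : 0 < l -> 0 < m ->
  A x y ->
  `|iter i (resolvent A l) x - iter j (resolvent A m) x| ^+ 2 <=
  `|y| ^+ 2 * ((i%:R * l - j%:R * m) ^+ 2 + l * (i%:R * l) + m * (j%:R * m)).
Proof.
move=> l0 m0 xy.
have base (g : R) (n : nat) : 0 < g ->
    `|iter n (resolvent A g) x - x| ^+ 2 <=
    `|y| ^+ 2 * ((n%:R * g) ^+ 2 + g * (n%:R * g)).
  move=> g0; apply: le_trans (_ : (n%:R * g * `|y|) ^+ 2 <= _).
    by rewrite lerXn2r ?nnegrE ?mulr_ge0// ?(ltW g0)//; exact: iter_resolvent_dist.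
  by rewrite exprMn mulrC ler_wpM2l ?sqr_ge0// lerDl !mulr_ge0// ltW.
elim: i j => [|i IHi] j.
  rewrite distrC; apply: le_trans (base m j m0) _.
  by rewrite !mul0r mulr0 addr0 sub0r sqrrN.
elim: j => [|j IHj].
  by apply: le_trans (base l i.+1 l0) _; rewrite !mul0r mulr0 addr0 subr0.
have h1 := resolvent_dist_le l m (iter i (resolvent A l) x)
  (iter j (resolvent A m) x) l0 m0.
have h2 := IHi j.+1; rewrite -!iterS in h1.
set D := `|_ - _| in h1 *; set D1 := `|_ - _| in h1 IHj; set D2 := `|_ - _| in h1 h2.
have lm0 : 0 < l + m by lra.
have lm2 : 0 < (l + m) ^+ 2 by rewrite exprn_gt0.
have D0 : 0 <= D by exact: normr_ge0.
have D10 : 0 <= D1 by exact: normr_ge0.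
have D20 : 0 <= D2 by exact: normr_ge0.
have h3 : ((l + m) * D) ^+ 2 <= (l * D1 + m * D2) ^+ 2.
  by rewrite lerXn2r ?nnegrE ?addr_ge0// mulr_ge0 ?(ltW lm0) ?(ltW l0) ?(ltW m0).
(* Convexity of the square brings in [D1 ^+ 2] and [D2 ^+ 2], which the induction hypotheses
   bound. *)
have h4 : (l * D1 + m * D2) ^+ 2 <= (l + m) * (l * D1 ^+ 2 + m * D2 ^+ 2).
  have : 0 <= l * m * (D1 - D2) ^+ 2 by rewrite mulr_ge0 ?sqr_ge0// mulr_ge0// ltW.
  by rewrite !expr2; lra.
have h5 := ler_wpM2l (ltW l0) IHj; have h6 := ler_wpM2l (ltW m0) h2.
have h7 := ler_wpM2l (ltW lm0) (lerD h5 h6).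
rewrite -(ler_pM2l lm2) -exprMn; apply: (le_trans h3); apply: (le_trans h4).
apply: (le_trans h7); rewrite le_eqVlt; apply/orP; left; apply/eqP.
by rewrite -!natr1; ring.
Qed.

(** Both schemes reach the same time [t], so the squared time difference in Kobayashi's estimate
    vanishes and only the step-size terms remain. *)
Lemma iter_resolvent_sub_sqr (t : R) (n N : nat) (x y : X) : 0 < t -> A x y ->
  (0 < N)%N -> (N <= n)%N ->
  `|iter N (resolvent A (t / N%:R)) x - iter n (resolvent A (t / n%:R)) x| ^+ 2 <=
  `|y| ^+ 2 * (2 * t ^+ 2 / N%:R).
Proof.
move=> t0 xy N0 Nn; have n0 : (0 < n)%N by exact: leq_trans Nn.
have pN : 0 < N%:R :> R by rewrite ltr0n.
have pn : 0 < n%:R :> R by rewrite ltr0n.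
have tE (k : nat) : 0 < k%:R :> R -> k%:R * (t / k%:R) = t.
  by move=> k0; rewrite mulrC divfK// gt_eqF.
apply: le_trans (iter_resolvent_dist_sqr _ _ N n x y (divr_gt0 t0 pN)
  (divr_gt0 t0 pn) xy) _.
rewrite !tE// subrr expr0n add0r ler_wpM2l ?sqr_ge0//.
have : t / n%:R * t <= t / N%:R * t.
  by rewrite ler_pM2r// ler_pM2l// lef_pV2// ler_nat.
have -> : 2 * t ^+ 2 / N%:R = t / N%:R * t + t / N%:R * t by ring.
lra.
Qed.

(** The Crandall-Liggett limit: the sequence is Cauchy from a nearby starting point [z] in [dom A],
    and nonexpansiveness transfers this to [x]. *)
Lemma is_cvg_iter_resolvent (t : R) (x : X) : 0 <= t -> closure (dom A) x ->
  cvg (iter n (resolvent A (t / n%:R)) x @[n --> \oo]).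
Proof.
rewrite le_eqVlt => /orP[/eqP <- _|t0 hx].
  rewrite (_ : (fun n => _) = cst x); first exact: is_cvg_cst.
  by apply/funext => n; rewrite mul0r; elim: n => //= n ->; exact: resolvent0.
apply: cauchy_seq_cvg => e e0.
have e3 : 0 < e / 3 by rewrite divr_gt0.
have [z [[y zy] xz]] := hx _ (nbhsx_ballx x _ e3).
rewrite -ball_normE /= in xz.
have e32 : 0 < (e / 3) ^+ 2 by rewrite exprn_gt0.
have [N [N0 hN]] := archimedean_nat (`|y| ^+ 2 * (2 * t ^+ 2)) _ e32.
exists N => n Nn.
have h := iter_resolvent_sub_sqr t n N z y t0 zy N0 Nn.
have tn (k : nat) : 0 <= t / k%:R by rewrite divr_ge0// ltW.
have h1 := iter_resolvent_nonexpansive (t / N%:R) N x z (tn N).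
have h2 := iter_resolvent_nonexpansive (t / n%:R) n x z (tn n).
rewrite mulrA in h; have := le_lt_trans h hN.
rewrite ltr_pXn2r ?nnegrE ?(ltW e3)// => h3.
set a := iter N _ x in h1 *; set b := iter n _ x in h2 *.
set c := iter N _ z in h1 h3; set d := iter n _ z in h2 h3.
have := ler_distD c a b; have := ler_distD d c b; rewrite (distrC d b).
lra.
Qed.

Lemma semigroup_cvg (t : R) (x : X) : 0 <= t -> closure (dom A) x ->
  iter n (resolvent A (t / n%:R)) x @[n --> \oo] --> semigroup A t x.
Proof. by move=> t0 hx; exact: is_cvg_iter_resolvent. Qed.

Lemma semigroup_nonexpansive (t : R) (x y : X) : 0 <= t -> closure (dom A) x ->
  closure (dom A) y -> `|semigroup A t x - semigroup A t y| <= `|x - y|.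
Proof.
move=> t0 hx hy; apply: cvg_dist_le (semigroup_cvg t x t0 hx) (semigroup_cvg t y t0 hy) _.
by near=> n; apply: iter_resolvent_nonexpansive; rewrite divr_ge0.
Unshelve. all: by end_near. Qed.

Lemma dom_closure (x y : X) : A x y -> closure (dom A) x.
Proof. by move=> xy; apply: subset_closure; exists y. Qed.

Lemma semigroup_zero (t : R) (p : X) : 0 <= t -> zeros A p -> semigroup A t p = p.
Proof.
move=> t0 hp; apply/cvg_lim => //.
rewrite (_ : (fun n => _) = cst p); first exact: cvg_cst.
by apply/funext => n; rewrite iter_resolvent_zero// divr_ge0.
Qed.

Lemma semigroup_approx (t : R) (i : nat) (x y : X) : 0 < t -> A x y -> (0 < i)%N ->
  `|iter i (resolvent A (t / i%:R)) x - semigroup A t x| ^+ 2 <=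
  `|y| ^+ 2 * (2 * t ^+ 2 / i%:R).
Proof.
move=> t0 xy i0.
have S0 : 0 <= `|y| ^+ 2 * (2 * t ^+ 2 / i%:R).
  by rewrite mulr_ge0 ?sqr_ge0// divr_ge0// mulr_ge0// sqr_ge0.
rewrite -[leRHS]sqr_sqrtr// lerXn2r ?nnegrE ?sqrtr_ge0//.
apply: cvg_dist_le (cvg_cst _) (semigroup_cvg t x (ltW t0) (dom_closure _ _ xy)) _.
near=> n; rewrite -(ler_sqr (R := R)) ?nnegrE ?sqrtr_ge0// sqr_sqrtr//.
apply: iter_resolvent_sub_sqr => //.
by near: n; exact: nbhs_infty_ge.
Unshelve. all: by end_near. Qed.

Lemma resolvent_fixed_zero (z : X) : resolvent A 1 z = z -> zeros A z.
Proof.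
by move=> h; have := resolventP 1 z ltr01; rewrite h subrr scaler0.
Qed.

Lemma zeros_seq_closed : seq_closed (zeros A).
Proof.
move=> v x hv vx; apply: resolvent_fixed_zero; apply/eqP.
rewrite -subr_eq0 -normr_le0; apply/ler_addgt0Pl => e e0; rewrite addr0.
have e2 : 0 < e / 2 by rewrite divr_gt0.
have /cvgrPdist_le/(_ _ e2)[n _ /(_ n (leqnn n)) hn] := vx.
have := resolvent_nonexpansive 1 x (v n) ler01; rewrite (resolvent_zero 1 (v n))//.
have := ler_distD (v n) (resolvent A 1 x) x; rewrite (distrC (v n) x).
by move: hn => /=; lra.
Qed.

(** Zeros are the fixed points of the nonexpansive resolvent. It sends the midpoint [q] to a point
    within [|x - y| / 2] of both [x] and [y], and by strict convexity that point is [q]. *)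
Lemma zeros_midpoint_convex : uniformly_convex X -> midpoint_convex (zeros A).
Proof.
move=> hc x y hx hy; apply: resolvent_fixed_zero.
set q := 2^-1 *: (x + y).
have qx : q - x = 2^-1 *: (y - x).
  by rewrite /q -{2}(half_scale_double x) -scalerBr opprD addrACA subrr add0r.
have qy : q - y = 2^-1 *: (x - y).
  by rewrite /q -{2}(half_scale_double y) -scalerBr opprD addrACA subrr addr0.
have h2 : 0 <= 2^-1 :> R by rewrite invr_ge0.
apply: (strict_convexity hc (2^-1 * `|x - y|) x y).
- have := resolvent_nonexpansive 1 q x ler01; rewrite (resolvent_zero 1 x)//.
  by move=> /le_trans; apply; rewrite qx normrZ ger0_norm// distrC.
- by rewrite qx normrZ ger0_norm// distrC.
- have := resolvent_nonexpansive 1 q y ler01; rewrite (resolvent_zero 1 y)//.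
  by move=> /le_trans; apply; rewrite qy normrZ ger0_norm.
- by rewrite qy normrZ ger0_norm.
- by rewrite mulrA mulfV ?mul1r ?pnatr_eq0.
Qed.

Lemma nearest_proj_zerosP (x p : X) : uniformly_convex X -> zeros A p ->
  nearest_points (zeros A) x (nearest_proj (zeros A) x).
Proof.
move=> hc hp; apply: xgetPex; apply: nearest_points_nonempty => //.
- by exists p.
- exact: zeros_seq_closed.
- exact: zeros_midpoint_convex.
Qed.

End Semigroup.

(** * Energy decrease along the implicit Euler scheme *)

Section SmallPairing.
Context {R : realType} {X : completeNormedModType R}.
Hypotheses (convexX : uniformly_convex X) (smoothX : uniformly_smooth X).
Variable A : X -> set X.
Hypothesis mA : m_accretive A.
Variable p : X.
Hypothesis Ap : zeros A p.

Let P := nearest_proj (zeros A).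

Let P_zeros (x : X) : zeros A (P x).
Proof. by have [] := nearest_proj_zerosP smoothX A mA x p convexX Ap. Qed.

Let P_nearest (x z : X) : zeros A z -> `|x - P x| <= `|x - z|.
Proof. by have [_] := nearest_proj_zerosP smoothX A mA x p convexX Ap; exact. Qed.

(** Accretivity against the zero [P a]; an upper bound on this pairing is thus a bound on its
    absolute value. *)
Lemma pairing_nearest_proj_ge0 (a b : X) : A a b -> 0 <= pairing b (a - P a).
Proof. by move=> ab; have := mA.1 _ _ _ _ ab (P_zeros a); rewrite subr0. Qed.

(* The subgradient inequality at [w - P z] gives the pairing with [J (w - P z)]; the
   error [e] pays for replacing [P z] by [P w]. *)
Lemma euler_step_decrease (g e : R) (z w : X) : 0 < g ->
  pairing (g^-1 *: (z - w)) (w - P w) - pairing (g^-1 *: (z - w)) (w - P z) <= e ->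
  2^-1 * `|w - P w| ^+ 2 + g * (pairing (g^-1 *: (z - w)) (w - P w) - e) <=
  2^-1 * `|z - P z| ^+ 2.
Proof.
move=> g0 he; have := half_sqr_norm_subgradient smoothX (w - P z) (z - w).
rewrite [w - P z + _]addrC addrA subrK.
have -> : pairing (z - w) (w - P z) = g * pairing (g^-1 *: (z - w)) (w - P z).
  by rewrite (pairingZ smoothX) mulVKf// gt_eqF.
have : `|w - P w| ^+ 2 <= `|w - P z| ^+ 2.
  by rewrite lerXn2r ?nnegrE//; exact: P_nearest.
by have := ler_wpM2l (ltW g0) he; lra.
Qed.

(** If the pairing exceeded [e] at each of the [m] Euler steps up to time [T], half the squared
    distance to the zeros, at most [r ^+ 2 / 2] initially, would become negative. *)
Lemma exists_small_pairing (r T e del : R) (x y : X) :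
  (forall e1 : R, 0 < e1 -> exists2 d : R, 0 < d & forall x1 x2 : X,
     `|x1 - p| <= r -> `|x2 - p| <= r -> `|x1 - x2| <= d -> `|P x1 - P x2| <= e1) ->
  0 < r -> 0 < T -> 2^-1 * r ^+ 2 < T * e -> 0 < del -> A x y -> `|x - p| <= r ->
  exists a b t, [/\ A a b, `|a - p| <= r, `|b| <= `|y|, 0 <= t <= T &
    `|pairing b (a - P a)| <= e /\ `|a - semigroup A t x| <= del].
Proof.
move=> Pcont r0 T0 Te del0 Axy xr.
(* Half of the slack in [r ^+ 2 / 2 < T * e], so that [T * (e - e') = r ^+ 2 / 2 + T * e'] still
   exceeds the initial energy. *)
pose e' := (e - 2^-1 * r ^+ 2 / T) / 2.
have e'0 : 0 < e' by rewrite divr_gt0// subr_gt0 ltr_pdivrMr// [e * T]mulrC.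
have Te' : 2 * (T * e') = T * e - 2^-1 * r ^+ 2 by rewrite /e'; field; lra.
have M0 : 0 < `|y| + 1 by rewrite ltr_wpDl.
have [d d0 Jd] := pairing_unif_continuous smoothX r (`|y| + 1) e' r0 M0 e'0.
have [d2 d20 Pd] := Pcont d d0.
have dd0 : 0 < del ^+ 2 by rewrite exprn_gt0.
have c10 : 0 <= T * `|y| / d2 by rewrite divr_ge0 ?mulr_ge0// ?(ltW T0) ?(ltW d20).
have c20 : 0 <= `|y| ^+ 2 * (2 * T ^+ 2) / del ^+ 2.
  by rewrite divr_ge0 ?sqr_ge0// mulr_ge0 ?sqr_ge0// mulr_ge0 ?sqr_ge0.
(* Taking [m] above the sum of two thresholds serves both: one Euler step moves by at most [d2], and
   Kobayashi's error is at most [del]. *)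
have [m [m0 hm]] := archimedean_nat
  (T * `|y| / d2 + `|y| ^+ 2 * (2 * T ^+ 2) / del ^+ 2) 1 ltr01.
have pm : 0 < m%:R :> R by rewrite ltr0n.
pose g := T / m%:R; have g0 : 0 < g by rewrite divr_gt0.
have mg : m%:R * g = T by rewrite /g mulrC divfK// gt_eqF.
rewrite ltr_pdivrMr// mul1r in hm.
have gd2 : g * `|y| <= d2.
  have : T * `|y| / d2 <= m%:R by lra.
  by rewrite ler_pdivrMr// /g mulrAC ler_pdivrMr// mulrC [m%:R * _]mulrC.
have gdel : `|y| ^+ 2 * (2 * T * g) <= del ^+ 2.
  have : `|y| ^+ 2 * (2 * T ^+ 2) / del ^+ 2 <= m%:R by lra.
  rewrite ler_pdivrMr// => h.
  have -> : `|y| ^+ 2 * (2 * T * g) = `|y| ^+ 2 * (2 * T ^+ 2) / m%:R.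
    by rewrite /g; field; rewrite gt_eqF.
  by rewrite ler_pdivrMr// [del ^+ 2 * _]mulrC.
pose z i := iter i (resolvent A g) x.
pose b i := g^-1 *: (z i - z i.+1).
have Azb i : A (z i.+1) (b i) by exact: resolventP.
have zp i : `|z i - p| <= r.
  apply: le_trans xr; rewrite -{1}(iter_resolvent_zero smoothX A mA g i p (ltW g0) Ap).
  exact: iter_resolvent_nonexpansive (ltW g0).
have zz i : `|z i - z i.+1| <= g * `|y| by exact: iter_resolvent_step.
have by' i : `|b i| <= `|y|.
  by rewrite normrZ gtr0_norm ?invr_gt0// ler_pdivrMl.
have zPp i : `|z i - P (z i)| <= r.
  by apply: le_trans (zp i); exact: P_nearest.
have Jclose i : pairing (b i) (z i.+1 - P (z i.+1)) - pairing (b i) (z i.+1 - P (z i)) <= e'.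
  apply: le_trans (ler_norm _) _; apply: Jd => //.
    by apply: le_trans (by' i) _; rewrite lerDl.
  rewrite opprB addrC addrA subrK; apply: Pd => //.
  exact: le_trans (zz i) gd2.
have [i [im hi]] : exists i, (i < m)%N /\ pairing (b i) (z i.+1 - P (z i.+1)) <= e.
  apply: contrapT => hn.
  have big i : (i < m)%N -> e < pairing (b i) (z i.+1 - P (z i.+1)).
    by move=> im; rewrite ltNge; apply/negP => h; apply: hn; exists i.
  have energy n : (n <= m)%N -> 2^-1 * `|z n - P (z n)| ^+ 2 + n%:R * (g * (e - e')) <=
      2^-1 * r ^+ 2.
    elim: n => [_|n IH nm].
      rewrite mul0r addr0 ler_pM2l ?invr_gt0// lerXn2r ?nnegrE// ?(ltW r0)//.
    have := IH (ltnW nm).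
    have := euler_step_decrease g e' (z n) (z n.+1) g0 (Jclose n).
    have := ler_wpM2l (ltW g0) (ltW (big n nm)).
    by rewrite -/(b n) -natr1; lra.
  have := energy m (leqnn m); rewrite mulrA mg.
  have : 0 <= `|z m - P (z m)| ^+ 2 by exact: sqr_ge0.
  by have := mulr_gt0 T0 e'0; lra.
have i0 : 0 < i.+1%:R :> R by rewrite ltr0n.
have iT : i.+1%:R * g <= T by rewrite -mg ler_pM2r// ler_nat.
exists (z i.+1), (b i), (i.+1%:R * g); split => //.
  by rewrite iT andbT mulr_ge0// ltW.
split; first by rewrite ger0_norm//; exact: pairing_nearest_proj_ge0.
have := semigroup_approx smoothX A mA (i.+1%:R * g) i.+1 x y (mulr_gt0 i0 g0) Axy isT.
(* At time [i.+1%:R * g] the exponential formula with [i.+1] factors has step exactly [g], so it is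
   the Euler iterate itself. *)
rewrite [X in iter _ (resolvent A X)](_ : _ = g); last by field; rewrite gt_eqF.
move=> h; rewrite -(ler_pXn2r (n := 2)) ?nnegrE ?(ltW del0)//.
apply: (le_trans h); apply: le_trans gdel; rewrite ler_wpM2l ?sqr_ge0//.
have -> : 2 * (i.+1%:R * g) ^+ 2 / i.+1%:R = 2 * (i.+1%:R * g) * g.
  by field; rewrite gt_eqF.
by rewrite ler_pM2r// ler_pM2l.
Qed.

End SmallPairing.

(** * The time bound [chi] and the final combination *)

Lemma chi_ge (R : realType) (B n : nat) :
  (2^-1 * (B%:R + 1) ^+ 2 + 1) * n.+1%:R <= (chi B n)%:R :> R.
Proof.
rewrite /chi natrM ler_wpM2r//; set q := _ + 1 : rat.
have q0 : 0 <= q by rewrite addr_ge0// mulr_ge0 ?sqr_ge0// invr_ge0.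
have : q <= `|Num.ceil q|%:R.
  rewrite natr_absz ger0_norm ?ceil_ge//.
  by rewrite ceil_ge0 (lt_le_trans _ q0).
rewrite /q; set z := `|_|%N => h.
(* Cleared of the factor 1/2, the bound is an inequality between natural numbers and passes from
   [rat] to [R]. *)
have : (((B + 1) ^ 2 + 2)%:R <= (2 * z)%:R :> rat).
  by rewrite natrD natrX natrD natrM; lra.
by rewrite ler_nat -(ler_nat R) natrD natrX natrD natrM; lra.
Qed.

Theorem theorem4p9 (R : realType) (X : completeNormedModType R)
  (hconvex : uniformly_convex X) (hsmooth : uniformly_smooth X)
  (A : X -> set X) (hA : m_accretive A)
  (Omega : nat -> (nat -> nat) -> nat -> nat)
  (hOmega : weak_modulus_convergence_condition A Omega)
  (p : X) (hp : zeros A p)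
  (omega : nat -> nat -> nat)
  (homega : uniform_continuity_modulus (nearest_proj (zeros A)) p omega)
  (homega_ge : forall r k : nat, (k <= omega r k)%N)
  (u : R -> X) (hu : almost_orbit A u)
  (Phi : nat -> nat)
  (hPhi : forall (k : nat) (s : R), (Phi k)%:R <= s ->
     (orbit_gap A u s <= (k.+1%:R^-1)%:E)%E)
  (B : nat) (hB : (0 < B)%N)
  (huB : forall t : R, 0 <= t -> `|u t - p| <= B%:R)
  (f : R -> nat -> nat)
  (hf_mono : forall s : R, 0 <= s -> forall m n : nat, (m <= n)%N -> (f s m <= f s n)%N)
  (hf : forall s : R, 0 <= s -> forall n : nat, exists x y : X,
     [/\ A x y, `|x| <= (f s n)%:R, `|y| <= (f s n)%:R & `|x - u s| <= n.+1%:R^-1])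
  (K : R -> nat -> nat)
  (hK : forall s : R, 0 <= s -> forall k : nat,
     (f s (omega (B + 1) (3 * k + 2)) <= K s k)%N /\ B%:R + 1 + `|p| <= (K s k)%:R) :
  forall k : nat,
    let k' := (24 * k + 23)%N in
    let sstar := Phi (omega B k') in
    forall t t' : R,
      (maxn (Phi (8 * k + 7)%N) (sstar + Omega_at Omega B (K sstar%:R k') k'))%:R <= t ->
      (maxn (Phi (8 * k + 7)%N) (sstar + Omega_at Omega B (K sstar%:R k') k'))%:R <= t' ->
      `|u t - u t'| <= k.+1%:R^-1.
Proof.
move=> k k' sstar t t'; set s : R := sstar%:R; set N := Omega_at _ _ _ _ => ht ht'.
have s0 : 0 <= s by [].
have [x [y [Axy xf yf xu]]] := hf s s0 (omega (B + 1)%N (3 * k' + 2)%N).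
have [hK1 hK2] := hK s s0 k'.
have k'E : (k'.+1%:R : R) = 24 * k.+1%:R.
  by rewrite -natrM; congr _%:R; rewrite /k' -addnS mulnS addnC.
(* All errors are counted in [eps], with [3 * eps = 1 / (k' + 1)]. Each of [u t] and [u t'] will be
   within [9 * eps] of [q], and [18 * eps = 1 / (4 * (k + 1))]. *)
pose eps : R := (3 * k' + 2).+1%:R^-1.
have eps0 : 0 < eps by rewrite invr_gt0.
have epsE : 3 * eps = k'.+1%:R^-1.
  rewrite /eps (_ : (3 * k' + 2).+1 = 3 * k'.+1)%N; last by rewrite -addnS mulnS addnC.
  by rewrite natrM invfM mulrA mulfV ?mul1r// pnatr_eq0.
have omega_le (r j : nat) : (omega r j).+1%:R^-1 <= j.+1%:R^-1 :> R.
  by rewrite lef_pV2 ?posrE ?ltr0n// ler_nat ltnS.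
have xu_eps : `|x - u s| <= eps by apply: le_trans xu (omega_le _ _).
have eps1 : eps <= 1 by rewrite invf_le1 ?ler1n.
have xr : `|x - p| <= (B + 1)%:R.
  by have := ler_distD (u s) x p; have := huB s s0; rewrite natrD; lra.
have Pcont (e : R) : 0 < e -> exists2 d : R, 0 < d & forall x1 x2 : X,
    `|x1 - p| <= (B + 1)%:R -> `|x2 - p| <= (B + 1)%:R -> `|x1 - x2| <= d ->
    `|nearest_proj (zeros A) x1 - nearest_proj (zeros A) x2| <= e.
  move=> e0; have [j [j0 hj]] := archimedean_nat 1 e e0.
  exists (omega (B + 1)%N j).+1%:R^-1; rewrite ?invr_gt0// => x1 x2 h1 h2 h.
  apply: le_trans (homega _ _ _ _ h1 h2 h) _; apply: le_trans (ltW hj).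
  by rewrite div1r lef_pV2 ?posrE ?ltr0n// ler_nat.
have approx n : exists abt : X * X * R, [/\ A abt.1.1 abt.1.2, `|abt.1.1 - p| <= (B + 1)%:R,
    `|abt.1.2| <= `|y|, 0 <= abt.2 <= (chi B n)%:R &
    `|pairing abt.1.2 (abt.1.1 - nearest_proj (zeros A) abt.1.1)| <= n.+1%:R^-1 /\
    `|abt.1.1 - semigroup A abt.2 x| <= eps].
  have chi0 := chi_ge R B n.
  have B2 : 0 <= (B%:R + 1) ^+ 2 :> R by exact: sqr_ge0.
  have n1 : 0 < n.+1%:R :> R by rewrite ltr0n.
  have [|||a [b [w h]]] := exists_small_pairing hconvex hsmooth A hA p hp
    (B + 1)%:R (chi B n)%:R n.+1%:R^-1 eps x y Pcont _ _ _ eps0 Axy xr.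
  - by rewrite ltr0n addn1.
  - by apply: lt_le_trans chi0; rewrite mulr_gt0//; lra.
  - by rewrite ltr_pdivlMr// natrD; apply: lt_le_trans chi0; rewrite ltr_pM2r//; lra.
  by exists (a, b, w).
have [g hg] := choice approx.
have normK z : `|z - p| <= (B + 1)%:R -> `|z| <= (K s k')%:R.
  move=> zp; have := ler_normD (z - p) p; rewrite subrK.
  by rewrite natrD in zp; lra.
have yK : `|y| <= (K s k')%:R by apply: le_trans yf _; rewrite ler_nat.
(* The [n]-th pairing is at most [1 / (n + 1)], so [id] is a rate of convergence. The argument
   [3 * k' + 2] makes the resulting distance at most [eps]. *)
have [||n nN hn] := hOmega (fun n => (g n).1.1) (fun n => (g n).1.2)
  (K s k') id _ _ (3 * k' + 2)%N.
- by move=> n; have [h1 h2 h3 _ _] := hg n; split=> //; [exact: normK|exact: le_trans yK].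
- move=> j n jn; have [_ _ _ _ [h _]] := hg n; apply: le_trans h _.
  by rewrite lef_pV2 ?posrE ?ltr0n// ler_nat ltnS.
have [Aab _ _ /andP[tau0 tauchi] [_ hSx]] := hg n.
set a := (g n).1.1 in hn hSx Aab; set tau := (g n).2 in tau0 tauchi hSx.
set q := nearest_proj _ _ in hn.
have Aq : zeros A q by have [] := nearest_proj_zerosP hsmooth A hA a p hconvex hp.
have [_ udom _] := hu.
have gap (v h : R) : s <= v -> 0 <= h ->
    `|u (v + h) - semigroup A h (u v)| <= 3 * eps.
  rewrite epsE => sv h0; have v0 : 0 <= v by exact: le_trans sv.
  apply: le_trans (omega_le B k').
  rewrite -lee_fin; apply: le_trans (hPhi _ _ sv).
  by apply: ereal_sup_ubound; exists h.
rewrite -/eps in hn; clearbody eps.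
(* The almost-orbit error contributes [3 * eps]; the distances from [u s] to [x], from the orbit of
   [x] to [a], and from [a] to [q] contribute [eps] each. *)
have close : `|u (s + tau) - q| <= 6 * eps.
  have := gap s tau (lexx _) tau0.
  have := semigroup_nonexpansive hsmooth A hA tau (u s) x tau0 (udom s s0)
    (dom_closure A x y Axy).
  rewrite (distrC (u s)).
  have := ler_distD (semigroup A tau (u s)) (u (s + tau)) q.
  have := ler_distD (semigroup A tau x) (semigroup A tau (u s)) q.
  have := ler_distD a (semigroup A tau x) q; rewrite (distrC _ a).
  lra.
have stau0 : 0 <= s + tau by rewrite addr_ge0.
(* The almost-orbit condition is used again, now from time [s + tau]: it adds [3 * eps] to the
   [6 * eps] that the semigroup preserves. *)
have final (v : R) : s + tau <= v -> `|u v - q| <= 9 * eps.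
  move=> hv; have h0 : 0 <= v - (s + tau) by rewrite subr_ge0.
  have := gap (s + tau) _ (_ : s <= s + tau) h0; rewrite lerDl => /(_ tau0).
  rewrite [s + tau + _]addrC subrK.
  have := semigroup_nonexpansive hsmooth A hA _ (u (s + tau)) q h0 (udom _ stau0)
    (dom_closure A q 0 Aq).
  rewrite (semigroup_zero hsmooth A hA _ _ h0 Aq).
  have := ler_distD (semigroup A (v - (s + tau)) (u (s + tau))) (u v) q.
  lra.
(* Since [n <= Omega (K s k') id (3 * k' + 2)] and [chi] is monotone, [tau <= chi B n <= N]. *)
have large (v : R) : (maxn (Phi (8 * k + 7)%N) (sstar + N))%:R <= v -> s + tau <= v.
  apply: le_trans; apply: (@le_trans _ _ (sstar + N)%:R); last first.
    by rewrite ler_nat leq_maxr.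
  rewrite natrD lerD2l; apply: le_trans tauchi _.
  by rewrite ler_nat /N /Omega_at /chi leq_mul2l ltnS nN orbT.
have := final _ (large _ ht); have := final _ (large _ ht').
have := ler_distD q (u t) (u t'); rewrite (distrC q).
have : 0 < k.+1%:R^-1 :> R by rewrite invr_gt0.
have := epsE; rewrite k'E invfM; move: (k.+1%:R^-1) => w.
lra.
Qed.
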